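(* Consider the sparse support recovery problem described in the context, with $\lim_{n\to\infty}s/n=0$. Any non-sequential uniform coordinate-wise procedure (which samples each coordinate $i=1,\dots,n$ exactly $m$ times) with $$\limsup_{n\to\infty}\frac{m}{\log n}<\frac{1}{D(P_1\|P_0)}$$ has $\liminf_{n\to\infty}\mathbb{P}_e\ge 1/2$.
   Context: Setting: $n$ is the dimension and $\mathcal S=\mathcal S(n)\subset\{1,\dots,n\}$ is an unknown support set with $|\mathcal S|=s\le n/2$; $s=s(n)$ and $m=m(n)$ are non-decreasing in $n$. $P_0\ne P_1$ are fixed probability densities (or mass functions) on a common space with common support, w.r.t. a common dominating measure; $D(P\|Q)=\mathbb{E}_P[\log(P(Y)/Q(Y))]$ denotes Kullback–Leibler divergence. For each $i$, samples $Y_{i,1},Y_{i,2},\dots$ are i.i.d. with $Y_{i,j}\sim P_0$ if $i\notin\mathcal S$ and $Y_{i,j}\sim P_1$ if $i\in\mathcal S$, independent across $i,j$. A non-sequential procedure fixes the numbers of samples in advance (not depending on any observations); a uniform coordinate-wise one samples every coordinate identically and decides membership of $i$ in the estimate $\hat{\mathcal S}$ by the same rule for all $i$, using only the samples of coordinate $i$. $\mathbb{P}_e=\mathbb{P}(\hat{\mathcal S}\ne\mathcal S)$.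
   Formalization: The support is assumed nonempty, s(n) ≥ 1 for every n ≥ 2; with s = 0 the claim fails, since the rule that never selects a coordinate makes no error. *)

(* Defs.v *)
From HB Require Import structures.
From mathcomp Require Import all_boot all_order all_algebra.
From mathcomp Require Import all_classical all_reals all_analysis.
Set Implicit Arguments. Unset Strict Implicit. Unset Printing Implicit Defensive.
Import Order.TTheory GRing.Theory Num.Theory.
Local Open Scope classical_set_scope.
Local Open Scope ring_scope.

Definition mutual_indep {d dT : measure_display} {Omega : measurableType d}
  {T : measurableType dT} {R : realType} (P : probability Omega R)
  {I : eqType} (X : I -> Omega -> T) : Prop :=
  forall (J : seq I) (B : I -> set T), uniq J ->
    (forall i, i \in J -> measurable (B i)) ->
    P (\bigcap_(i in [set` J]) (X i @^-1` B i)) =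
    (\prod_(i <- J) P (X i @^-1` B i))%E.

Definition dens_prob {dT : measure_display} {T : measurableType dT} {R : realType}
  (mu : {measure set T -> \bar R}) (p : T -> R) (A : set T) : \bar R :=
  (\int[mu]_(y in A) (p y)%:E)%E.

Definition is_density {dT : measure_display} {T : measurableType dT} {R : realType}
  (mu : {measure set T -> \bar R}) (p : T -> R) : Prop :=
  [/\ measurable_fun setT p, (forall y, 0 <= p y) & dens_prob mu p setT = 1%E].

(* Kullback-Leibler divergence D(P1 || P0) = E_{P1}[log (p1/p0)]
   (integral over the support of p1, with the convention 0 log 0 = 0). *)
Definition KL {dT : measure_display} {T : measurableType dT} {R : realType}
  (mu : {measure set T -> \bar R}) (p1 p0 : T -> R) : \bar R :=
  (\int[mu]_(y in [set y | (0 < p1 y)%R]) ((p1 y * ln (p1 y / p0 y))%R)%:E)%E.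

Definition coord_samples {d : measure_display} {Omega : measurableType d} {T : Type}
  (n m : nat) (Y : 'I_n -> nat -> Omega -> T) (i : 'I_n) (w : Omega) : m.-tuple T :=
  [tuple Y i (nat_of_ord j) w | j < m].

(* Estimated support of a uniform coordinate-wise rule with acceptance region A:
   i is declared in the support iff its m samples fall in A. *)
Definition Shat {d : measure_display} {Omega : measurableType d} {T : Type}
  (n m : nat) (Y : 'I_n -> nat -> Omega -> T) (A : set (m.-tuple T)) (w : Omega)
  : {set 'I_n} :=
  [set i : 'I_n | `[< A (coord_samples m Y i w) >]].

Definition err_prob {d dT : measure_display} {Omega : measurableType d}
  {T : measurableType dT} {R : realType} (P : probability Omega R)
  (n m : nat) (Y : 'I_n -> nat -> Omega -> T) (A : set (m.-tuple T)) (S : {set 'I_n})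
  : \bar R :=
  P [set w | Shat Y A w <> S].

(* Main.v *)
Require Import Defs.
From HB Require Import structures.
From mathcomp Require Import all_boot all_order all_algebra.
From mathcomp Require Import all_classical all_reals all_analysis.
From mathcomp Require Import measurable_realfun ring lra.
Import Order.TTheory GRing.Theory Num.Theory.
Import numFieldNormedType.Exports.
Import HBSimple HBNNSimple.
Local Open Scope classical_set_scope.
Local Open Scope ring_scope.

(* Suppose that P(Shat = S) > 1/2. The n - s null coordinates are rejected
   independently, each with probability 1 - a, so (1 - a)^(n - s) > 1/2 and the
   false alarm probability a is at most 2 / n; and a support coordinate is
   detected with probability q > 1/2. Writing r = p1 / p0, changing measure from
   P1^m to P0^m on the event {prod_j r(Y_j) <= e^t} gives
     q <= e^t a + P1^m (sum_j ln r(Y_j) > t).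
   If m <= c ln n with c D < 1 and t lies strictly between c D ln n and ln n,
   then e^t a -> 0, and the last probability tends to 0 by the weak law of large
   numbers under the sole assumption E_1 |ln r| < oo: ln r is within eps in L^1
   of a bounded function V, the difference is handled by Markov's inequality and
   the sum of the V(Y_j) by Chernoff's bound with a small fixed lambda. Hence
   q -> 0, a contradiction. *)

(** * Integrals and independence *)

(** The last hypothesis makes [nu] the image under [X] of the measure of density [G]. The formula
    then holds for indicators, by linearity for simple functions, and by monotone convergence along
    [nnsfun_approx]. Taking [G = 1] handles laws of variables, and [X = id] handles densities. *)
Lemma ge0_integral_transfer {d1 d2 : measure_display} {R : realType}
    {Omega : measurableType d1} {T : measurableType d2}
    (m : {measure set Omega -> \bar R}) (nu : {measure set T -> \bar R})
    (X : Omega -> T) (G : Omega -> R) (f : T -> \bar R) :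
  measurable_fun setT X -> measurable_fun setT G -> (forall w, 0 <= G w) ->
  measurable_fun setT f -> (forall y, 0 <= f y)%E ->
  (forall B, measurable B -> (\int[m]_(w in X @^-1` B) (G w)%:E)%E = nu B) ->
  (\int[m]_w (f (X w) * (G w)%:E) = \int[nu]_y f y)%E.
Proof.
move=> mX mG G0 mf f0 GB.
have mGE : measurable_fun setT (EFin \o G) by exact/measurable_EFinP.
pose g := nnsfun_approx measurableT mf.
have mgE n : measurable_fun [set: T] (EFin \o g n) by exact/measurable_EFinP.
have ndg x : {homo (fun n => (g n x)%:E) : n k / (n <= k)%O >-> (n <= k)%E}.
  by move=> n k nk; rewrite lee_fin; exact/lefP/nd_nnsfun_approx.
have simple n : (\int[m]_w ((g n (X w))%:E * (G w)%:E) = \int[nu]_y (g n y)%:E)%E.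
  rewrite integralT_nnsfun sintegralE.
  transitivity (\int[m]_w (\sum_(x \in range (g n))
      (x%:E * (\1_(g n @^-1` [set x]) (X w))%:E * (G w)%:E)))%E.
    apply: eq_integral => w _; rewrite fimfunE -fsumEFin//.
    by rewrite ge0_mule_fsuml// => x; rewrite EFinM nnfun_muleindic_ge0.
  have mI x : measurable_fun setT
      (fun w => (\1_(g n @^-1` [set x]) (X w) : R)%:E).
    apply/measurable_EFinP.
    exact: (measurableT_comp (measurable_indic _) mX).
  rewrite ge0_integral_fsum//.
  - apply: eq_fsbigr => x xr.
    have x0 : (0 <= x) by move: xr; rewrite inE => -[y _ <-].
    under eq_integral do rewrite -muleA.
    rewrite ge0_integralZl//; last 2 first.
    + by apply: emeasurable_funM.
    + by move=> w _; rewrite mule_ge0// lee_fin.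
    congr (_ * _)%E; rewrite -GB//.
    rewrite [RHS]integral_mkcond; apply: eq_integral => w _.
    rewrite patchE/= indicE; case: ifPn => h.
      by rewrite mem_set ?mul1e//; exact: set_mem h.
    rewrite memNset ?mul0e// => h'; move/negP: h; apply.
    exact: mem_set.
  - by move=> x; apply: emeasurable_funM => //; apply: emeasurable_funM.
  - by move=> x w _; apply: mule_ge0; [exact: (nnfun_muleindic_ge0 (g n))|rewrite lee_fin].
transitivity (limn (fun n => \int[nu]_x (g n x)%:E)%E); last first.
  rewrite -monotone_convergence//; last by move=> n x _; rewrite lee_fin.
  apply: eq_integral => t _.
  by apply/cvg_lim => //; exact: cvg_nnsfun_approx.
rewrite -(_ : (fun n => \int[m]_w ((g n (X w))%:E * (G w)%:E))%E
            = (fun n => \int[nu]_x (g n x)%:E)%E); last exact/funext.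
rewrite -monotone_convergence//.
- apply: eq_integral => w _; apply/esym/cvg_lim => //.
  by apply: cvgeZr => //; exact: cvg_nnsfun_approx.
- move=> n; apply: emeasurable_funM => //; exact: (measurableT_comp (mgE n)).
- by move=> n w _; rewrite mule_ge0// lee_fin.
- by move=> w _ n k nk; apply: lee_wpmul2r; [rewrite lee_fin|exact: ndg].
Qed.

(* The indicators of the B i are traded for the f i one index at a time: with all
   the other factors fixed, both sides are finite measures of the remaining set. *)
Lemma indep_integral_prod_on {d dT : measure_display} {Omega : measurableType d}
    {T : measurableType dT} {R : realType} (P : probability Omega R)
    {I : eqType} (X : I -> Omega -> T) (f : I -> T -> R) (a : I -> R)
    (J K : seq I) (B : I -> set T) :
  mutual_indep P X -> (forall i, measurable_fun setT (X i)) ->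
  (forall i, measurable_fun setT (f i)) -> (forall i y, 0 <= f i y) ->
  (forall i, \int[P]_w (f i (X i w))%:E = (a i)%:E)%E ->
  uniq (J ++ K) -> (forall i, i \in K -> measurable (B i)) ->
  (\int[P]_(w in \bigcap_(i in [set` K]) (X i @^-1` B i))
      (\prod_(i <- J) f i (X i w))%:E =
   (\prod_(i <- J) a i * \prod_(i <- K) fine (P (X i @^-1` B i)))%:E)%E.
Proof.
move=> PX mX mf f0 fa.
have mXB i A : measurable A -> measurable (X i @^-1` A).
  by move=> mA; rewrite -[_ @^-1` _]setTI; exact: mX.
have a0 i : 0 <= a i.
  by rewrite -lee_fin -fa; apply: integral_ge0 => w _; rewrite lee_fin.
have mfX i : measurable_fun setT (fun w => f i (X i w)).
  exact: (measurableT_comp (mf i) (mX i)).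
have mE (K' : seq I) B' : (forall i, i \in K' -> measurable (B' i)) ->
    measurable (\bigcap_(i in [set` K']) (X i @^-1` B' i)).
  move=> mB'; apply: fin_bigcap_measurable; first exact: finite_seq.
  by move=> i iK; apply/mXB/mB'.
elim: J K B => [|i J IH] K B uJK mB.
  rewrite big_nil mul1r; under eq_integral do rewrite big_nil.
  rewrite integral_cst ?mul1e; last exact: mE.
  apply: (etrans (PX K B uJK mB)); rewrite -prodEFin; apply: eq_big_seq => i iK.
  by rewrite fineK// fin_num_measure//; exact/mXB/mB.
pose G w := \prod_(j <- J) f j (X j w) *
  \1_(\bigcap_(i in [set` K]) (X i @^-1` B i)) w.
pose c : R := \prod_(j <- J) a j * \prod_(j <- K) fine (P (X j @^-1` B j)).
have c0 : 0 <= c.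
  by rewrite mulr_ge0//; apply: prodr_ge0 => // j _; exact: fine_ge0.
have /andP[iJK uJ] : (i \notin J ++ K) && uniq (J ++ K) by [].
have mG : measurable_fun setT G.
  apply: measurable_funM; first exact: measurable_prod.
  by apply: measurable_indic; exact: mE.
have G0 w : 0 <= G w.
  by rewrite mulr_ge0// prodr_ge0.
transitivity (\int[P]_w ((f i (X i w))%:E * (G w)%:E))%E.
  rewrite integral_mkcond; apply: eq_integral => w _.
  rewrite patchE big_cons /G indicE -EFinM mulrA.
  by case: ifPn => _; rewrite ?mulr1 ?mulr0.
(* With weight [G], the image measure under [X i] is [c] times the law of [X i]: on a set [A] this
   is the induction hypothesis with [i] moved from [J] to [K] and carrying the set [A]. *)
rewrite (ge0_integral_transfer _ (mscale (NngNum c0) (pushforward P (X i)))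
  (X i) G (EFin \o f i))//.
- have mfE : measurable_fun setT (EFin \o f i) by exact/measurable_EFinP.
  rewrite ge0_integral_mscale//; last by move=> y _; rewrite lee_fin.
  rewrite ge0_integral_pushforward//; last by move=> y _; rewrite lee_fin.
  by rewrite preimage_setT fa big_cons -EFinM mulrC mulrA.
- exact/measurable_EFinP.
- by move=> y; rewrite lee_fin.
- move=> A mA.
  pose B' j := if j == i then A else B j.
  have B'i : B' i = A by rewrite /B' eqxx.
  have B'j j : j \in K -> B' j = B j.
    rewrite /B'; case: eqP => // -> iK.
    by move: iJK; rewrite mem_cat iK orbT.
  have EE : \bigcap_(j in [set` i :: K]) (X j @^-1` B' j) =
      X i @^-1` A `&` \bigcap_(j in [set` K]) (X j @^-1` B j).
    apply/seteqP; split=> [w Ew|w [Aw Ew] j /=].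
      split; first by rewrite /= -B'i; apply: Ew; rewrite /= mem_head.
      by move=> j jK /=; rewrite -(B'j _ jK); apply: Ew; rewrite /= inE jK orbT.
    rewrite inE => /orP[/eqP ->|jK]; first by rewrite B'i.
    by rewrite B'j//; exact: Ew.
  have mXA := mXB i A mA.
  transitivity (\int[P]_(w in \bigcap_(j in [set` i :: K]) (X j @^-1` B' j))
      (\prod_(j <- J) f j (X j w))%:E)%E.
    rewrite EE integral_mkcondr; apply: eq_integral => w _.
    rewrite patchE /G indicE.
    by case: ifPn => _; rewrite ?mulr1 ?mulr0.
  rewrite IH.
  - transitivity (c * fine (P (X i @^-1` A)))%:E; last first.
      by rewrite EFinM fineK ?fin_num_measure.
    rewrite big_cons B'i [fine _ * _]mulrC mulrA /c; congr (_ * _ * _)%:E.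
    by apply: eq_big_seq => j jK; rewrite B'j.
  - by rewrite -cat1s uniq_catCA.
  - move=> j; rewrite inE => /orP[/eqP ->|jK]; first by rewrite B'i.
    by rewrite B'j//; exact: mB.
Qed.

(** * Laws of sample tuples *)

(** The family [C] is indexed by [nat], like the samples of a coordinate, so that independence can
    be applied along [iota 0 m]. *)
Definition rect {T : Type} (m : nat) (C : nat -> set T) : set (m.-tuple T) :=
  [set y | forall j : 'I_m, C j (tnth y j)].

Lemma measurable_rect {d : measure_display} {T : measurableType d} (m : nat)
    (C : nat -> set T) :
  (forall j, measurable (C j)) -> measurable (rect m C).
Proof.
move=> mC; rewrite (_ : rect m C =
    \bigcap_(j in [set: 'I_m]) ((fun y => tnth y j) @^-1` C j)).
  apply: fin_bigcap_measurable; first exact: finite_finset.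
  by move=> j _; rewrite -[_ @^-1` _]setTI; exact: measurable_tnth.
by apply/seteqP; split=> [y Cy j _|y Cy j]; [exact: Cy|exact: Cy].
Qed.

(** Measurable rectangles are stable under intersection, contain [setT] and generate the product
    sigma-algebra, so uniqueness of finite measures on a pi-system applies. *)
Lemma tuple_measure_unique {d : measure_display} {T : measurableType d}
    {R : realType} (m : nat) (m1 m2 : {measure set (m.-tuple T) -> \bar R}) :
  (m1 setT < +oo)%E ->
  (forall C : nat -> set T, (forall j, measurable (C j)) ->
    m1 (rect m C) = m2 (rect m C)) ->
  forall A, measurable A -> m1 A = m2 A.
Proof.
move=> m1oo m12.
pose G := [set rect m C | C in [set C : nat -> set T | forall j, measurable (C j)]].
have GT : G setT.
  by exists (fun=> setT) => // ; apply/seteqP; split.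
apply: (measure_unique G (fun=> setT)) => //.
- apply/seteqP; split.
  + apply: smallest_sub; first exact: smallest_sigma_algebra.
    apply: (big_ind (fun A => A `<=` <<s G >>)) => //.
    * by move=> A B GA GB y [/GA|/GB].
    * move=> i _ _ [A mA <-]; apply: sub_sigma_algebra.
      exists (fun j => if j == i :> nat then A else setT).
        by move=> j /=; case: ifP.
      rewrite setTI; apply/seteqP; split=> [y /(_ i)|y Ay j] /=.
        by rewrite eqxx.
      by case: ifPn => // /eqP/val_inj ->.
  + apply: smallest_sub; first exact: sigma_algebra_measurable.
    by move=> _ [C mC <-]; exact: measurable_rect.
- move=> _ _ [C mC <-] [D mD <-].
  exists (fun j => C j `&` D j); first by move=> j; exact: measurableI.
  by apply/seteqP; split=> [y CDy|y [Cy Dy] j]; [split=> j; case: (CDy j)|split].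
- by rewrite bigcup_const.
- by move=> _ [C mC <-]; exact: m12.
Qed.

Lemma tuple_law_unique {d1 d2 d : measure_display} {O1 : measurableType d1}
    {O2 : measurableType d2} {T : measurableType d} {R : realType} (m : nat)
    (m1 : {measure set O1 -> \bar R}) (m2 : {measure set O2 -> \bar R})
    (W1 : O1 -> m.-tuple T) (W2 : O2 -> m.-tuple T) :
  measurable_fun setT W1 -> measurable_fun setT W2 -> (m1 setT < +oo)%E ->
  (forall C : nat -> set T, (forall j, measurable (C j)) ->
    m1 (W1 @^-1` rect m C) = m2 (W2 @^-1` rect m C)) ->
  forall A, measurable A -> m1 (W1 @^-1` A) = m2 (W2 @^-1` A).
Proof.
move=> mW1 mW2 m1oo m12.
have /(_ mW1 mW2) := tuple_measure_unique m (pushforward m1 W1) (pushforward m2 W2).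
by apply.
Qed.

Lemma measurable_coord_samples {d dT : measure_display} {Omega : measurableType d}
    {T : measurableType dT} (n m : nat) (Y : 'I_n -> nat -> Omega -> T) (i : 'I_n) :
  (forall i j, measurable_fun setT (Y i j)) ->
  measurable_fun setT (coord_samples m Y i).
Proof.
move=> mY; apply/measurable_fun_tnthP => j.
rewrite (_ : _ \o _ = Y i j)//.
by apply/funext => w /=; rewrite tnth_mktuple.
Qed.

Section density_measure.
Context {d : measure_display} {T : measurableType d} {R : realType}.
Variables (mu : {measure set T -> \bar R}) (f : T -> R).
Hypotheses (mf : measurable_fun setT f) (f0 : forall y, 0 <= f y).

(* The two proofs are arguments so that the measure structure can be inferred
   from the term. *)
Definition density_measure of measurable_fun setT f & (forall y, 0 <= f y) :=
  fun A : set T => (\int[mu]_(y in A) (f y)%:E)%E.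

Let nu := density_measure mf f0.

Let nu0 : nu set0 = 0%E. Proof. exact: integral_set0. Qed.

Let nu_ge0 A : (0 <= nu A)%E.
Proof. by apply: integral_ge0 => y _; rewrite lee_fin. Qed.

Let nu_sigma_additive : semi_sigma_additive nu.
Proof.
apply: semi_sigma_additive_nng_induced => [|y]; last by rewrite lee_fin.
exact/measurable_EFinP.
Qed.

HB.instance Definition _ := isMeasure.Build _ _ _ nu nu0 nu_ge0 nu_sigma_additive.

End density_measure.

Lemma preimage_rect_coord {Omega T : Type} (n m : nat)
    (Y : 'I_n -> nat -> Omega -> T) (i : 'I_n) (C : nat -> set T) :
  (fun w => [tuple Y i (nat_of_ord j) w | j < m]) @^-1` rect m C =
  \bigcap_(j in [set` iota 0 m]) (Y i j @^-1` C j).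
Proof.
apply/seteqP; split=> w Cw.
  move=> j /=; rewrite mem_iota add0n => jm.
  by have := Cw (Ordinal jm); rewrite tnth_mktuple.
rewrite /rect /= => j.
by rewrite tnth_mktuple; apply: Cw; rewrite /= mem_iota add0n ltn_ord.
Qed.

(** The pairs (i, j) with [i] in [K] and [j < m] are distinct indices of one independent family, so
    the double product is a single product over [allpairs]. *)
Lemma indep_rect {d dT : measure_display} {Omega : measurableType d}
    {T : measurableType dT} {R : realType} (P : probability Omega R) (n m : nat)
    (Y : 'I_n -> nat -> Omega -> T) (K : seq 'I_n) (C : 'I_n -> nat -> set T) :
  mutual_indep P (fun ij : 'I_n * nat => Y ij.1 ij.2) ->
  uniq K -> (forall i j, measurable (C i j)) ->
  P (\bigcap_(i in [set` K]) (coord_samples m Y i @^-1` rect m (C i))) =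
  (\prod_(i <- K) \prod_(j <- iota 0 m) P (Y i j @^-1` C i j))%E.
Proof.
move=> PY uK mC.
have := PY [seq (i, j) | i <- K, j <- iota 0 m] (fun ij => C ij.1 ij.2).
rewrite big_allpairs /= => <-.
- congr (P _); apply/seteqP; split=> [w Cw [i j] /= /allpairsP[[k l] /= [kK lm [-> ->]]]|w Cw i iK].
    by have := Cw _ kK; rewrite preimage_rect_coord; exact.
  rewrite preimage_rect_coord => j jm.
  by apply: (Cw (i, j)) => /=; exact: allpairs_f.
- apply: allpairs_uniq => //; first exact: iota_uniq.
  by move=> [i j] [k l] _ _ /= [-> ->].
- by move=> [i j] _; exact: mC.
Qed.

(* Rectangles are traded for arbitrary measurable sets one coordinate i at a time. *)
Lemma indep_coord_samples {d dT : measure_display} {Omega : measurableType d}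
    {T : measurableType dT} {R : realType} (P : probability Omega R) (n m : nat)
    (Y : 'I_n -> nat -> Omega -> T) :
  (forall i j, measurable_fun setT (Y i j)) ->
  mutual_indep P (fun ij : 'I_n * nat => Y ij.1 ij.2) ->
  mutual_indep P (coord_samples m Y).
Proof.
move=> mY PY J B uJ mB.
have mW i : measurable_fun setT (coord_samples m Y i).
  exact: measurable_coord_samples.
have mWB i A : measurable A -> measurable (coord_samples m Y i @^-1` A).
  by move=> mA; rewrite -[_ @^-1` _]setTI; exact: mW.
pose isrect (A : set (m.-tuple T)) :=
  exists2 C : nat -> set T, (forall j, measurable (C j)) & A = rect m C.
suff gen (J' K : seq 'I_n) (D : 'I_n -> set (m.-tuple T)) : uniq (J' ++ K) ->
    (forall i, i \in J' ++ K -> measurable (D i)) ->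
    (forall i, i \in K -> isrect (D i)) ->
    P (\bigcap_(i in [set` J' ++ K]) (coord_samples m Y i @^-1` D i)) =
    (\prod_(i <- J' ++ K) P (coord_samples m Y i @^-1` D i))%E.
  by have := gen J [::] B; rewrite cats0; apply.
elim: J' K D => [|i J' IH] K D uJK mD rD.
  rewrite cat0s in uJK *.
  have : forall i, exists C : nat -> set T,
      (forall j, measurable (C j)) /\ (i \in K -> D i = rect m C).
    move=> i; have [/rD[C mC DC]|iK] := boolP (i \in K); first by exists C.
    by exists (fun=> setT).
  move=> /choice[C mC].
  have eqD i : i \in K -> coord_samples m Y i @^-1` D i =
      coord_samples m Y i @^-1` rect m (C i).
    by move=> iK; rewrite (mC i).2.
  rewrite (_ : \bigcap_(i in _) _ =
      \bigcap_(i in [set` K]) (coord_samples m Y i @^-1` rect m (C i))); last first.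
    by apply: eq_bigcapr => i /eqD.
  rewrite (indep_rect P n m Y K C PY) //; last by move=> i; exact: (mC i).1.
  apply: eq_big_seq => i iK; rewrite eqD//.
  have := indep_rect P n m Y [:: i] C PY.
  rewrite big_seq1 => <- //; last by move=> k; exact: (mC k).1.
  by congr (P _); apply/seteqP; split=> [w Cw|w Cw k /=];
    [apply: Cw; rewrite /= mem_head|rewrite inE => /eqP ->].
have /andP[iJK uJK'] : (i \notin J' ++ K) && uniq (J' ++ K) by [].
have mD' k : k \in J' ++ K -> measurable (D k).
  by move=> kJK; apply: mD; rewrite cat_cons inE kJK orbT.
pose E := \bigcap_(k in [set` J' ++ K]) (coord_samples m Y k @^-1` D k).
have mE : measurable E.
  apply: fin_bigcap_measurable; first exact: finite_seq.
  by move=> k kJK; apply: mWB; exact: mD'.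
have PE : P E = (\prod_(k <- J' ++ K) P (coord_samples m Y k @^-1` D k))%E.
  by apply: IH => //; move=> k kK; exact: rD.
pose c : {nonneg R} := NngNum (fine_ge0 (measure_ge0 P E)).
have splitE A (D' := fun k => if k == i then A else D k) :
    \bigcap_(k in [set` i :: J' ++ K]) (coord_samples m Y k @^-1` D' k) =
    coord_samples m Y i @^-1` A `&` E.
  apply/seteqP; split=> [w Dw|w [Aw Ew] k /=].
    split; first by have := Dw i (mem_head _ _); rewrite /D' /= eqxx.
    move=> k kJK; have := Dw k; rewrite /D' /=.
    rewrite inE kJK orbT; case: eqP => [ki|_]; last exact.
    by move: iJK; rewrite -ki kJK.
  rewrite inE /D' /=; case: eqP => [-> _ //|_ /= kJK].
  exact: Ew.
have mscaleE A : mscale c P A = (P E * P A)%E.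
  by rewrite -[X in (X * _)%E]fineK ?fin_num_measure.
(* With the event [E] of the other coordinates fixed, both sides are finite measures of [A]. On
   rectangles they agree by the induction hypothesis with [i] moved into [K], hence they agree on
   every measurable set. *)
have key : forall A, measurable A ->
    mrestr P mE (coord_samples m Y i @^-1` A) =
    mscale c P (coord_samples m Y i @^-1` A).
  apply: tuple_law_unique => //.
    by rewrite ltey_eq fin_num_measure.
  move=> C mC; apply: (etrans _ (esym (mscaleE _))).
  suff : P (coord_samples m Y i @^-1` rect m C `&` E) =
    (P E * P (coord_samples m Y i @^-1` rect m C))%E by [].
  pose D' k := if k == i then rect m C else D k.
  have D'E k : k \in J' ++ K -> D' k = D k.
    by rewrite /D'; case: eqP => // ->; rewrite (negbTE iJK).
  have eqJK : perm_eq (i :: (J' ++ K)) (J' ++ i :: K).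
    by rewrite perm_sym -cat1s perm_catCA.
  have -> : coord_samples m Y i @^-1` rect m C `&` E =
      \bigcap_(k in [set` J' ++ i :: K]) (coord_samples m Y k @^-1` D' k).
    rewrite -splitE; congr (bigcap _ _); apply/seteqP.
    by split=> k /=; rewrite (perm_mem eqJK).
  rewrite IH.
  - transitivity (\prod_(k <- i :: (J' ++ K)) P (coord_samples m Y k @^-1` D' k))%E.
      by apply: perm_big; rewrite perm_sym.
    rewrite big_cons {1}/D' eqxx [RHS]muleC; congr (_ * _)%E.
    by rewrite PE; apply: eq_big_seq => k kJK; rewrite D'E.
  - by rewrite -(perm_uniq eqJK).
  - move=> k; rewrite -(perm_mem eqJK) inE => /orP[/eqP ->|kJK].
      by rewrite /D' eqxx; exact: measurable_rect.
    by rewrite D'E//; exact: mD'.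
  - move=> k; rewrite inE => /orP[/eqP ->|kK].
      by rewrite /D' eqxx; exists C.
    by rewrite D'E ?mem_cat ?kK ?orbT//; exact: rD.
have {key} := etrans (key (D i) (mD i (mem_head _ _))) (mscaleE _).
rewrite big_cons -PE muleC => <-.
transitivity (P (coord_samples m Y i @^-1` D i `&` E)) => //; rewrite -splitE.
by congr (P _); apply: eq_bigcapr => k _; case: eqP => // ->.
Qed.

(** * Change of measure and deviation bounds *)

Lemma mutual_indep_coord {d dT : measure_display} {Omega : measurableType d}
    {T : measurableType dT} {R : realType} (P : probability Omega R) (n : nat)
    (Y : 'I_n -> nat -> Omega -> T) (i : 'I_n) :
  mutual_indep P (fun ij : 'I_n * nat => Y ij.1 ij.2) -> mutual_indep P (Y i).
Proof.
move=> PY J B uJ mB.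
have := PY [seq (i, j) | j <- J] (fun ij => B ij.2).
rewrite big_map /= => <-.
- congr (P _); apply/seteqP; split=> [w Bw _ /= /mapP[j jJ ->]|w Bw j jJ]; first exact: Bw.
  by apply: (Bw (i, j)); exact: map_f.
- by rewrite map_inj_uniq// => j k [].
- by move=> _ /mapP[j jJ ->]; exact: mB.
Qed.

(** The weight [r] turns the law of each sample of [i0] into that of [i1]. By independence the
    product of the weights does so for rectangles of samples, and rectangles determine a finite
    measure. *)
Lemma change_of_measure {d dT : measure_display} {Omega : measurableType d}
    {T : measurableType dT} {R : realType} (P : probability Omega R) (n m : nat)
    (Y : 'I_n -> nat -> Omega -> T) (i0 i1 : 'I_n) (r : T -> R)
    (A : set (m.-tuple T)) :
  (forall i j, measurable_fun setT (Y i j)) ->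
  mutual_indep P (fun ij : 'I_n * nat => Y ij.1 ij.2) ->
  measurable_fun setT r -> (forall y, 0 <= r y) ->
  (forall j B, measurable B ->
    (\int[P]_(w in Y i0 j @^-1` B) (r (Y i0 j w))%:E)%E = P (Y i1 j @^-1` B)) ->
  measurable A ->
  (\int[P]_(w in coord_samples m Y i0 @^-1` A)
     (\prod_(j <- iota 0 m) r (Y i0 j w))%:E)%E =
  P (coord_samples m Y i1 @^-1` A).
Proof.
move=> mY PY mr r0 rP.
pose G w := \prod_(j <- iota 0 m) r (Y i0 j w).
have mG : measurable_fun setT G.
  by apply: measurable_prod => j _; exact: (measurableT_comp mr (mY i0 j)).
have G0 w : 0 <= G w by rewrite /G prodr_ge0.
move=> mA; symmetry.
suff : P (coord_samples m Y i1 @^-1` A) =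
    density_measure P G mG G0 (coord_samples m Y i0 @^-1` A) by [].
have mYB i j B : measurable B -> measurable (Y i j @^-1` B).
  by move=> mB; rewrite -[_ @^-1` _]setTI; exact: mY.
apply: (tuple_law_unique m P (density_measure P G mG G0)) => //.
- exact: measurable_coord_samples.
- exact: measurable_coord_samples.
- by rewrite ltey_eq fin_num_measure.
move=> C mC; rewrite /density_measure !preimage_rect_coord.
apply: (etrans (mutual_indep_coord P n Y i1 PY _ _ (iota_uniq 0 m) (fun j _ => mC j))).
(* The indicator of the rectangle is absorbed into the factors, so that the integral of a product of
   independent variables applies with [K] empty. *)
pose f j y := r y * \1_(C j) y.
transitivity (\int[P]_w (\prod_(j <- iota 0 m) f j (Y i0 j w))%:E)%E; last first.
  rewrite [RHS]integral_mkcond; apply: eq_integral => w _.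
  rewrite patchE; case: ifPn => [/set_mem Cw|Cw].
    congr EFin; apply: eq_big_seq => j jm.
    by rewrite /f indicE mem_set ?mulr1//; exact: Cw.
  have [j jm Cjw] : exists2 j, j \in iota 0 m & ~ C j (Y i0 j w).
    apply: contrapT => nC; move/negP: Cw; apply; apply/mem_set => j jm.
    by apply: contrapT => Cjw; apply: nC; exists j.
  rewrite (big_rem j)//= /f indicE memNset// mulr0 mul0r//.
have fint j : (\int[P]_w (f j (Y i0 j w))%:E = (fine (P (Y i1 j @^-1` C j)))%:E)%E.
  rewrite fineK ?fin_num_measure//; last exact: mYB.
  rewrite -rP// [RHS]integral_mkcond; apply: eq_integral => w _.
  rewrite patchE /f indicE; case: ifPn => [/set_mem Cw|/negP Cw].
    by rewrite mem_set ?mulr1.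
  by rewrite memNset ?mulr0// => Cw'; apply: Cw; exact: mem_set.
have := indep_integral_prod_on P (Y i0) f (fun j => fine (P (Y i1 j @^-1` C j)))
  (iota 0 m) [::] (fun=> setT) (mutual_indep_coord P n Y i0 PY) (mY i0).
rewrite big_nil mulr1 (_ : bigcap _ _ = setT); last first.
  by apply/seteqP; split.
move=> ->//.
- rewrite -prodEFin; apply: eq_big_seq => j jm.
  by rewrite fineK// fin_num_measure//; exact: mYB.
- by move=> j; apply: measurable_funM => //; exact: measurable_indic.
- by move=> j y; rewrite mulr_ge0.
- by rewrite cats0 iota_uniq.
Qed.

(** Split [A] according to whether the likelihood ratio [g] is at most [t]: on that part the change
    of measure costs a factor at most [t], and the rest is bounded by the probability that [g]
    exceeds [t]. *)
Lemma change_of_measure_le {d dT : measure_display} {Omega : measurableType d}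
    {T : measurableType dT} {R : realType} (P : probability Omega R) (n m : nat)
    (Y : 'I_n -> nat -> Omega -> T) (i0 i1 : 'I_n) (r : T -> R)
    (A : set (m.-tuple T)) (t : R) :
  (forall i j, measurable_fun setT (Y i j)) ->
  mutual_indep P (fun ij : 'I_n * nat => Y ij.1 ij.2) ->
  measurable_fun setT r -> (forall y, 0 <= r y) ->
  (forall j B, measurable B ->
    (\int[P]_(w in Y i0 j @^-1` B) (r (Y i0 j w))%:E)%E = P (Y i1 j @^-1` B)) ->
  measurable A -> 0 <= t ->
  (P (coord_samples m Y i1 @^-1` A) <=
   t%:E * P (coord_samples m Y i0 @^-1` A) +
   P [set w | (t < \prod_(j <- iota 0 m) r (Y i1 j w))%R])%E.
Proof.
move=> mY PY mr r0 rP mA t0.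
have mW i : measurable_fun setT (coord_samples m Y i).
  exact: measurable_coord_samples.
have mWB i B : measurable B -> measurable (coord_samples m Y i @^-1` B).
  by move=> mB; rewrite -[_ @^-1` _]setTI; exact: mW.
pose g (y : m.-tuple T) := \prod_(j < m) r (tnth y j).
have mg : measurable_fun setT g.
  apply: measurable_prod => j _.
  exact: (measurableT_comp mr (measurable_tnth j)).
have gE i w : g (coord_samples m Y i w) = \prod_(j <- iota 0 m) r (Y i j w).
  rewrite -[X in iota 0 X]subn0 big_mkord.
  by apply: eq_bigr => j _; rewrite tnth_mktuple.
pose H := [set y | g y <= t].
have mH : measurable H.
  rewrite (_ : H = g @^-1` `]-oo, t]); last first.
    by apply/seteqP; split=> y; rewrite /H /= in_itv.
  by rewrite -[_ @^-1` _]setTI; exact: mg.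
apply: (@le_trans _ _ (P (coord_samples m Y i1 @^-1` (A `&` H)) +
    P (coord_samples m Y i1 @^-1` (~` H)))%E).
  rewrite -measureU; last 3 first.
  - exact/mWB/measurableI.
  - exact/mWB/measurableC.
  - by apply/seteqP; split=> // w [[_ Hw] nHw]; exact: nHw.
  apply: le_measure; rewrite ?inE; first exact: mWB.
    by apply: measurableU; apply: mWB; [exact: measurableI|exact: measurableC].
  by move=> w Aw; have [Hw|Hw] := pselect (H (coord_samples m Y i1 w)); [left|right].
apply: leeD; last first.
  rewrite le_eqVlt; apply/orP; left; apply/eqP; congr (P _).
  by apply/seteqP; split=> w; rewrite /H /= gE ltNge => /negP.
have mAH := measurableI _ _ mA mH.
rewrite -(change_of_measure P n m Y i0 i1 r (A `&` H) mY PY mr r0 rP mAH).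
apply: (@le_trans _ _ (\int[P]_(w in coord_samples m Y i0 @^-1` (A `&` H)) t%:E)%E).
  apply: ge0_le_integral => //.
  - exact: mWB.
  - by move=> w _; rewrite lee_fin prodr_ge0.
  - apply/measurable_EFinP; apply: measurable_prod => j _.
    by apply: measurable_funTS; exact: (measurableT_comp mr (mY i0 j)).
  - by move=> w [_]; rewrite /H /= gE lee_fin.
rewrite integral_cst; last exact: mWB.
rewrite lee_wpmul2l ?lee_fin//; apply: le_measure; rewrite ?inE; try exact: mWB.
by move=> w [].
Qed.

(** Since exp(-x) >= 1 - x, exp(x) is at most 1 / (1 - x), and (1 + x + 2 x^2) (1 - x) = 1 + x^2 (1
    - 2 x) >= 1. *)
Lemma expR_le_quadratic {R : realType} (x : R) :
  x <= 1 / 2 -> expR x <= 1 + x + 2 * x ^+ 2.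
Proof.
move=> x2; have x1 : 0 < 1 - x by lra.
have : 1 - x <= (expR x)^-1 by rewrite -expRN expR_ge1Dx.
rewrite -lef_pV2 ?posrE ?invr_gt0 ?expR_gt0// invrK => /le_trans; apply.
rewrite -div1r ler_pdivrMr//.
have : 0 <= x ^+ 2 * (1 - 2 * x) by rewrite mulr_ge0 ?sqr_ge0//; lra.
nra.
Qed.

Lemma markov_ge0 {d : measure_display} {Omega : measurableType d} {R : realType}
    (P : {measure set Omega -> \bar R}) (h : Omega -> R) (a : R) :
  measurable_fun setT h -> (forall w, 0 <= h w) -> 0 <= a ->
  (a%:E * P [set w | (a <= h w)%R] <= \int[P]_w (h w)%:E)%E.
Proof.
move=> mh h0 a0.
have mE : measurable [set w | (a <= h w)%R].
  rewrite (_ : [set w | _] = h @^-1` `[a, +oo[); last first.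
    by apply/seteqP; split=> w; rewrite /= in_itv /= andbT.
  by rewrite -[_ @^-1` _]setTI; exact: mh.
rewrite -integral_cst//.
apply: (@le_trans _ _ (\int[P]_(w in [set w | (a <= h w)%R]) (h w)%:E)%E).
  apply: ge0_le_integral => //.
  by apply/measurable_EFinP; exact: measurable_funTS.
apply: ge0_subset_integral => //; first exact/measurable_EFinP.
by move=> w _; rewrite lee_fin.
Qed.

(** Integrating the quadratic bound on the exponential gives 1 + lam v + 2 (lam K)^2, and 1 + y <=
    exp(y) puts it in a form that multiplies well over samples. *)
Lemma bounded_mgf_le {d : measure_display} {Omega : measurableType d}
    {R : realType} (P : probability Omega R) (V : Omega -> R) (K v lam : R) :
  measurable_fun setT V -> (forall w, `|V w| <= K) ->
  (\int[P]_w (V w)%:E = v%:E)%E -> 0 <= lam -> lam * K <= 1 / 2 ->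
  (\int[P]_w (expR (lam * V w))%:E <=
   (expR (lam * v + 2 * (lam * K) ^+ 2))%:E)%E.
Proof.
move=> mV VK Vv lam0 lamK.
have intc (c : R) : P.-integrable setT (EFin \o cst c).
  exact: (finite_measure_integrable_cst P c measurableT).
have intV : P.-integrable setT (EFin \o V).
  apply: (le_integrable measurableT _ _ (intc K)); first exact/measurable_EFinP.
  by move=> w _ /=; rewrite lee_fin (le_trans (VK w))// ler_norm.
apply: (@le_trans _ _ (\int[P]_w
    ((1 + 2 * (lam * K) ^+ 2)%:E + lam%:E * (V w)%:E))%E).
  apply: ge0_le_integral => //.
  - apply/measurable_EFinP; apply: (measurableT_comp (@measurable_expR R)).
    exact: measurable_funM.
  - apply: emeasurable_funD => //; apply: emeasurable_funM => //.
    exact/measurable_EFinP.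
  - move=> w _; rewrite -EFinM -EFinD lee_fin.
    have h : `|lam * V w| <= lam * K by rewrite normrM ger0_norm// ler_wpM2l.
    have h2 : (lam * V w) ^+ 2 <= (lam * K) ^+ 2.
      by rewrite -[X in X <= _]real_normK ?num_real// lerXn2r// ?nnegrE// (le_trans _ h).
    have := expR_le_quadratic (lam * V w).
    move: h; rewrite ler_norml => /andP[_ h] /(_ (le_trans h lamK)) h3.
    by apply: (le_trans h3); lra.
have intlV : P.-integrable setT (fun w => lam%:E * (V w)%:E)%E.
  exact: integrableZl.
rewrite integralD//; last exact: intc.
have -> : (\int[P]_w (1 + 2 * (lam * K) ^+ 2)%:E = (1 + 2 * (lam * K) ^+ 2)%:E)%E.
  rewrite integral_cst// -[RHS]mule1; congr (_ * _)%E; exact: probability_setT.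
rewrite integralZl// Vv -EFinM -EFinD.
rewrite lee_fin; apply: le_trans (expR_ge1Dx _).
lra.
Qed.

(** If the sum of the [Z] exceeds [t], then either the sum of the [V] is at least [t - t1] or the
    sum of the |Z - V| is at least [t1]. Chernoff's bound treats the first event, where the
    variables are bounded, and Markov's inequality the second. *)
Lemma sum_deviation_le {d dT : measure_display} {Omega : measurableType d}
    {T : measurableType dT} {R : realType} (P : probability Omega R)
    (X : nat -> Omega -> T) (Z V : T -> R) (m : nat) (K v lam eps t t1 : R) :
  mutual_indep P X -> (forall j, measurable_fun setT (X j)) ->
  measurable_fun setT Z -> measurable_fun setT V ->
  (forall y, `|V y| <= K) ->
  (forall j, \int[P]_w (V (X j w))%:E = v%:E)%E ->
  (forall j, \int[P]_w (`|Z (X j w) - V (X j w)|)%:E <= eps%:E)%E ->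
  0 <= lam -> lam * K <= 1 / 2 -> 0 < t1 ->
  (P [set w | (t < \sum_(j <- iota 0 m) Z (X j w))%R] <=
   (expR (m%:R * (lam * v + 2 * (lam * K) ^+ 2) - lam * (t - t1))
    + m%:R * eps / t1)%:E)%E.
Proof.
move=> PX mX mZ mV VK Vv ZV lam0 lamK t10.
pose SV w := \sum_(j <- iota 0 m) V (X j w).
pose SD w := \sum_(j <- iota 0 m) `|Z (X j w) - V (X j w)|.
pose SE w := \prod_(j <- iota 0 m) expR (lam * V (X j w)).
have mSD : measurable_fun setT SD.
  apply: measurable_sum => j; apply: measurableT_comp => //.
  by apply: measurable_funB; [exact: (measurableT_comp mZ)|exact: (measurableT_comp mV)].
have mElV : measurable_fun setT (fun y => expR (lam * V y)).
  by apply: measurableT_comp => //; exact: measurable_funM.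
have mSE : measurable_fun setT SE.
  by apply: measurable_prod => j _; exact: (measurableT_comp mElV (mX j)).
have SEE w : SE w = expR (lam * SV w).
  by rewrite /SE /SV mulr_sumr expR_sum.
have mge (h : Omega -> R) a : measurable_fun setT h -> measurable [set w | (a <= h w)%R].
  move=> mh; rewrite (_ : [set w | _] = h @^-1` `[a, +oo[); last first.
    by apply/seteqP; split=> w; rewrite /= in_itv /= andbT.
  by rewrite -[_ @^-1` _]setTI; exact: mh.
have mgt (h : Omega -> R) a : measurable_fun setT h -> measurable [set w | (a < h w)%R].
  move=> mh; rewrite (_ : [set w | _] = h @^-1` `]a, +oo[); last first.
    by apply/seteqP; split=> w; rewrite /= in_itv /= andbT.
  by rewrite -[_ @^-1` _]setTI; exact: mh.
pose a : R := expR (lam * (t - t1)).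
have a0 : 0 < a by exact: expR_gt0.
apply: (@le_trans _ _ (P [set w | (a <= SE w)%R] + P [set w | (t1 <= SD w)%R])%E).
  apply: (@le_trans _ _ (P ([set w | (a <= SE w)%R] `|` [set w | (t1 <= SD w)%R]))).
    apply: le_measure; rewrite ?inE.
    - apply: mgt; apply: measurable_sum => j; exact: (measurableT_comp mZ (mX j)).
    - by apply: measurableU; exact: mge.
    - move=> w /= tw; have [h|h] := leP t1 (SD w); [by right|left].
      rewrite /a SEE ler_expR ler_wpM2l//.
      have : \sum_(j <- iota 0 m) Z (X j w) <= SV w + SD w.
        rewrite -big_split /=; apply: ler_sum => j _.
        by have := ler_norm (Z (X j w) - V (X j w)); lra.
      by lra.
  by apply: measureU2; exact: mge.
rewrite EFinD; apply: leeD.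
- have SE0 w : 0 <= SE w by rewrite SEE expR_ge0.
  have := markov_ge0 P SE a mSE SE0 (ltW a0).
  have aE j : (\int[P]_w (expR (lam * V (X j w)))%:E =
      (fine (\int[P]_w (expR (lam * V (X j w)))%:E))%:E)%E.
    rewrite fineK// ge0_fin_numE; last first.
      by apply: integral_ge0 => w _; rewrite lee_fin expR_ge0.
    apply: (le_lt_trans (bounded_mgf_le P (V \o X j) K v lam _ _ (Vv j) lam0 lamK)).
    + exact: (measurableT_comp mV).
    + by move=> w; exact: VK.
    + exact: ltry.
  have := indep_integral_prod_on P X (fun _ y => expR (lam * V y)) _
    (iota 0 m) [::] (fun=> setT) PX mX (fun=> mElV) (fun _ _ => expR_ge0 _) aE.
  rewrite (_ : bigcap _ _ = setT); last by apply/seteqP; split.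
  rewrite cats0 iota_uniq big_nil mulr1 => -> // h.
  rewrite -(@lee_pmul2l _ a%:E) ?lte_fin//.
  apply: (le_trans h).
  rewrite /a -EFinM -expRD addrC subrK lee_fin expRM_natl.
  rewrite -[X in iota 0 X]subn0 big_mkord.
  rewrite -[X in _ ^+ X]card_ord -prodr_const; apply: ler_prod => j _.
  rewrite -!lee_fin -aE; apply/andP; split.
    by apply: integral_ge0 => w _; rewrite lee_fin expR_ge0.
  apply: (bounded_mgf_le P (V \o X j) K v lam _ _ (Vv j) lam0 lamK).
    exact: (measurableT_comp mV).
  by move=> w; exact: VK.
- have SD0 w : 0 <= SD w by rewrite /SD sumr_ge0.
  have h := markov_ge0 P SD t1 mSD SD0 (ltW t10).
  rewrite -(@lee_pmul2l _ t1%:E) ?lte_fin//.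
  apply: (le_trans h).
  rewrite -EFinM mulrC divfK ?gt_eqF//.
  under eq_integral do rewrite -sumEFin.
  rewrite ge0_integral_sum//.
  + apply: (@le_trans _ _ (\sum_(j <- iota 0 m) eps%:E)%E).
      by apply: lee_sum => j _; exact: ZV.
    rewrite sumEFin lee_fin -[X in iota 0 X]subn0 big_mkord.
    by rewrite sumr_const card_ord mulr_natl.
  + move=> j; apply/measurable_EFinP; apply: measurableT_comp => //.
    by apply: measurable_funB; [exact: (measurableT_comp mZ)|exact: (measurableT_comp mV)].
Qed.

(** * The log-likelihood ratio *)

(** Positive and negative parts are transferred separately; multiplication by [G >= 0] commutes with
    taking either part. *)
Lemma integral_transfer {d1 d2 : measure_display} {R : realType}
    {Omega : measurableType d1} {T : measurableType d2}
    (m : {measure set Omega -> \bar R}) (nu : {measure set T -> \bar R})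
    (X : Omega -> T) (G : Omega -> R) (h : T -> R) :
  measurable_fun setT X -> measurable_fun setT G -> (forall w, 0 <= G w) ->
  measurable_fun setT h ->
  (forall B, measurable B -> (\int[m]_(w in X @^-1` B) (G w)%:E)%E = nu B) ->
  (\int[m]_w (h (X w) * G w)%:E = \int[nu]_y (h y)%:E)%E.
Proof.
move=> mX mG G0 mh GB; have mhE : measurable_fun setT (EFin \o h) by exact/measurable_EFinP.
rewrite integralE [RHS]integralE.
rewrite -(ge0_integral_transfer m nu X G (EFin \o h)^\+%E)//; last exact: measurable_funepos.
rewrite -(ge0_integral_transfer m nu X G (EFin \o h)^\-%E)//; last exact: measurable_funeneg.
congr (_ - _)%E; apply: eq_integral => w _.
  rewrite !funeposE /= -!EFin_max -EFinM; congr EFin.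
  by rewrite maxr_pMl// mul0r.
rewrite !funenegE /= -?EFinN -!EFin_max -EFinM; congr EFin.
by rewrite maxr_pMl// mul0r mulNr.
Qed.

(** With u = ln (b / a) the expression equals a (exp(u) - 1 - u), which is nonnegative and vanishes
    only at u = 0. *)
Lemma gibbs_pointwise {R : realType} (a b : R) : 0 < a -> 0 < b ->
  0 <= a * ln (a / b) - a + b /\ (a * ln (a / b) - a + b = 0 -> a = b).
Proof.
move=> a0 b0.
have x0 : 0 < b / a by rewrite divr_gt0.
have lnE : ln (a / b) = - ln (b / a) by rewrite -lnV ?posrE// invf_div.
set u := ln (b / a) in lnE; rewrite lnE.
have eu : expR u = b / a by rewrite /u lnK// posrE.
have bE : b = a * expR u by rewrite eu mulrC divfK// gt_eqF.
have -> : a * - u - a + b = a * (expR u - (1 + u)) by rewrite bE; ring.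
split; first by rewrite mulr_ge0 ?(ltW a0)// subr_ge0 expR_ge1Dx.
have [u0 _|/expR_gt1Dx h] := eqVneq u 0; first by rewrite bE u0 expR0 mulr1.
by move/eqP; rewrite mulf_eq0 (gt_eqF a0)/= subr_eq0 (gt_eqF h).
Qed.

Section log_likelihood_ratio.
Context {d : measure_display} {T : measurableType d} {R : realType}.
Variables (mu : {measure set T -> \bar R}) (p0 p1 : T -> R).
Hypotheses (mp0 : measurable_fun setT p0) (p0_ge0 : forall y, 0 <= p0 y).
Hypotheses (p0_1 : dens_prob mu p0 setT = 1%E).
Hypotheses (mp1 : measurable_fun setT p1) (p1_ge0 : forall y, 0 <= p1 y).
Hypotheses (p1_1 : dens_prob mu p1 setT = 1%E).
Hypothesis supp : forall y, 0 < p0 y <-> 0 < p1 y.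

Lemma dens_eq0 y : p1 y = 0 -> p0 y = 0.
Proof.
move=> py; apply/eqP; rewrite eq_le p0_ge0 andbT leNgt; apply/negP => /supp.
by rewrite py ltxx.
Qed.

(* On the support, 1 / p0 is written exp (- ln p0); off it, p1 = 0. *)
Lemma measurable_lr : measurable_fun setT (fun y => p1 y / p0 y).
Proof.
rewrite (_ : (fun y => _) = (fun y => p1 y * expR (- ln (p0 y)))).
  apply: measurable_funM => //; apply: (measurableT_comp (@measurable_expR R)).
  by apply: measurableT_comp => //; exact: (measurableT_comp (@measurable_ln R)).
apply/funext => y; have [py|py] := eqVneq (p1 y) 0; first by rewrite py !mul0r.
have : 0 < p1 y by rewrite lt0r py p1_ge0.
by move/supp => p0y; rewrite expRN lnK.
Qed.

Lemma measurable_llr : measurable_fun setT (fun y => ln (p1 y / p0 y)).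
Proof. exact: (measurableT_comp (@measurable_ln R) measurable_lr). Qed.

(** Where [p1] vanishes both integrands are 0; elsewhere [supp] gives [p0 > 0] and the densities
    cancel. *)
Lemma integral_lr B : measurable B ->
  (\int[density_measure mu p0 mp0 p0_ge0]_(y in B) (p1 y / p0 y)%:E)%E =
  dens_prob mu p1 B.
Proof.
move=> mB; rewrite integral_mkcond /dens_prob [RHS]integral_mkcond.
rewrite -(ge0_integral_transfer mu _ id p0)//.
- apply: eq_integral => y _; rewrite !patchE; case: ifPn => _; last by rewrite mul0e.
  rewrite -EFinM; congr EFin.
  have [py|py] := eqVneq (p1 y) 0; first by rewrite py !mul0r.
  by rewrite divfK// gt_eqF//; apply/supp; rewrite lt0r py p1_ge0.
- apply/(measurable_restrictT _ _).1 => //.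
  by apply/measurable_EFinP; apply: measurable_funTS; exact: measurable_lr.
- by move=> y; rewrite patchE; case: ifPn => // _; rewrite lee_fin divr_ge0.
Qed.

Lemma KLE : KL mu p1 p0 = (\int[mu]_y (p1 y * ln (p1 y / p0 y))%:E)%E.
Proof.
rewrite /KL integral_mkcond; apply: eq_integral => y _.
rewrite patchE; case: ifPn => // /negP py.
have -> : p1 y = 0; last by rewrite mul0r.
apply/eqP; rewrite eq_le p1_ge0 andbT leNgt; apply/negP => h; apply: py.
exact/mem_set.
Qed.

Let f y := p1 y * ln (p1 y / p0 y).

Let mf : measurable_fun setT (EFin \o f).
Proof. by apply/measurable_EFinP; apply: measurable_funM => //; exact: measurable_llr. Qed.

(** Both densities have mass 1, so when [f] is integrable [g] has the same integral, while being
    pointwise nonnegative. *)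
Let g y := f y - p1 y + p0 y.

Lemma gibbs_ge0 y : 0 <= p1 y * ln (p1 y / p0 y) - p1 y + p0 y.
Proof.
have [py|py] := eqVneq (p1 y) 0.
  by rewrite (dens_eq0 _ py) py mul0r subr0 addr0.
have py0 : 0 < p1 y by rewrite lt0r py p1_ge0.
by apply: (gibbs_pointwise _ _ py0 _).1; exact/supp.
Qed.

Lemma gibbs_eq0 y : p1 y * ln (p1 y / p0 y) - p1 y + p0 y = 0 -> p1 y = p0 y.
Proof.
have [py _|py] := eqVneq (p1 y) 0; first by rewrite (dens_eq0 _ py).
have py0 : 0 < p1 y by rewrite lt0r py p1_ge0.
by apply: (gibbs_pointwise _ _ py0 _).2; exact/supp.
Qed.

Lemma integrable_density (p : T -> R) : is_density mu p ->
  mu.-integrable setT (EFin \o p).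
Proof.
move=> [mp pge0 p1']; apply/integrableP; split; first exact/measurable_EFinP.
rewrite (eq_integral (EFin \o p)); first by rewrite [X in (X < _)%E]p1' ltry.
by move=> y _ /=; rewrite ger0_norm.
Qed.

(** Gibbs' pointwise inequality bounds the negative part of [f] by [p0], hence its integral by 1. So
    either the positive part has infinite integral or [f] is integrable. In the latter case the
    divergence is the integral of [g >= 0], and its vanishing would force [p1 = p0] almost
    everywhere. *)
Lemma KL_finite_pos :
  ~ (forall B, measurable B -> dens_prob mu p0 B = dens_prob mu p1 B) ->
  KL mu p1 p0 = +oo%E \/
  exists D : R, [/\ 0 < D, KL mu p1 p0 = D%:E &
    mu.-integrable setT (fun y => (p1 y * ln (p1 y / p0 y))%:E)].
Proof.
move=> neq; rewrite KLE.
have int0 : mu.-integrable setT (EFin \o p0) by exact: integrable_density.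
have int1 : mu.-integrable setT (EFin \o p1) by exact: integrable_density.
have neg1 : (\int[mu]_y (EFin \o f)^\- y <= 1)%E.
  rewrite -p0_1 /dens_prob; apply: ge0_le_integral => //.
  - exact: measurable_funeneg.
  - exact/measurable_EFinP.
  - move=> y _; rewrite !funenegE /= -?EFinN -EFin_max lee_fin ge_max p0_ge0 andbT.
    by have := gibbs_ge0 y; have := p1_ge0 y; rewrite /f; lra.
have [pos|pos] := eqVneq (\int[mu]_y (EFin \o f)^\+ y)%E +oo%E.
  left; rewrite integralE [X in (X - _)%E]pos addye//.
  by rewrite eqe_oppLR /= lt_eqF// (le_lt_trans neg1)// ltry.
right.
have intf : mu.-integrable setT (EFin \o f).
  apply/integrableP; split => //.
  have -> : (\int[mu]_y `|(EFin \o f) y| =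
      \int[mu]_y ((EFin \o f)^\+ y + (EFin \o f)^\- y))%E.
    by apply: eq_integral => y _; rewrite -[LHS]/((abse \o (EFin \o f)) y) fune_abse.
  rewrite ge0_integralD//; [|exact: measurable_funepos|exact: measurable_funeneg].
  by rewrite lte_add_pinfty// ?(le_lt_trans neg1) ?ltry// ltey.
exists (fine (\int[mu]_y (f y)%:E)); rewrite fineK ?integrable_fin_num//; split => //.
have intfp : mu.-integrable setT (fun y => (f y)%:E - (p1 y)%:E)%E.
  exact: integrableB.
have gE : (\int[mu]_y (g y)%:E = \int[mu]_y (f y)%:E)%E.
  under eq_integral do rewrite /g EFinD EFinB.
  rewrite integralD// integralB//.
  rewrite [X in (_ - X + _)%E]p1_1 [X in (_ + X)%E]p0_1.
  by rewrite subeK.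
rewrite -lte_fin fineK ?integrable_fin_num// -gE lt0e; apply/andP; split; last first.
  by apply: integral_ge0 => y _; rewrite lee_fin; exact: gibbs_ge0.
apply/eqP => g0; apply: neq => B mB.
have mg : measurable_fun setT (EFin \o g).
  apply/measurable_EFinP; apply: measurable_funD => //; apply: measurable_funB => //.
  exact/measurable_EFinP.
have : ae_eq mu setT (EFin \o g) (cst 0%E).
  apply/ae_eq_integral_abs => //; rewrite -[RHS]g0; apply: eq_integral => y _ /=.
  by rewrite ger0_norm//; exact: gibbs_ge0.
move=> ae; rewrite /dens_prob; apply: ge0_ae_eq_integral => //.
- by apply/measurable_EFinP; exact: measurable_funTS.
- by apply/measurable_EFinP; exact: measurable_funTS.
- by move=> y _; rewrite lee_fin.
- by move=> y _; rewrite lee_fin.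
- move: ae; apply: filterS => y /(_ I) [] /gibbs_eq0 e _.
  by rewrite e.
Qed.

End log_likelihood_ratio.

(** Simple functions are bounded and dense in L^1, and means differ by at most the L^1 distance. *)
Lemma bounded_L1_approx {d : measure_display} {T : measurableType d}
    {R : realType} (nu : {measure set T -> \bar R}) (h : T -> R) (D eps : R) :
  nu.-integrable setT (EFin \o h) -> (\int[nu]_y (h y)%:E = D%:E)%E -> 0 < eps ->
  exists V : T -> R, exists K v : R,
    [/\ measurable_fun setT V, 0 <= K /\ (forall y, `|V y| <= K),
      (\int[nu]_y (V y)%:E = v%:E)%E, v <= D + eps &
      (\int[nu]_y (`|h y - V y|)%:E <= eps%:E)%E].
Proof.
move=> ih hD eps0.
have [V_ [iV _ V0]] := approximation_sfun_integrable measurableT ih.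
have [n Vn] : exists n, (\int[nu]_y (`|h y - V_ n y|)%:E <= eps%:E)%E.
  have /fine_cvgP[[N1 _ fin]] := V0.
  move=> /cvgrPdist_le/(_ _ eps0)[N2 _ close].
  exists (maxn N1 N2).
  have := close (maxn N1 N2) (leq_maxr _ _).
  rewrite /= sub0r normrN => le.
  have f1 := fin (maxn N1 N2) (leq_maxl _ _).
  have := le_trans (ler_norm _) le; rewrite -lee_fin fineK//.
have [B [Breal VB]] := simple_bounded (V_ n).
have Vfin := integrable_fin_num measurableT (iV n).
(* The bound from [simple_bounded] holds for every constant strictly above [B], hence the added
   1. *)
exists (V_ n), (`|B| + 1), (fine (\int[nu]_y (V_ n y)%:E)); split => //.
- split=> [|y]; first by rewrite addr_ge0.
  apply: (VB (`|B| + 1)) => //.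
  by rewrite (le_lt_trans (ler_norm B))// ltrDl.
- by rewrite fineK.
- have ihV : nu.-integrable setT (fun y => (h y)%:E - (V_ n y)%:E)%E.
    by apply: integrableB => //; exact: iV.
  rewrite -lee_fin EFinD fineK// -hD -leeBlDl//; last by rewrite hD.
  apply: (@le_trans _ _ (`|\int[nu]_y ((h y)%:E - (V_ n y)%:E)|)%E).
    rewrite integralB//; last exact: iV.
    by rewrite -abseN fin_num_oppeB// addeC hD; exact: lee_abs.
  apply: (le_trans (le_abse_integral nu measurableT _)); last exact: Vn.
  by case/integrableP: ihV.
Qed.

(** * Support recovery *)

(** A division-free form of (1 - a)^k <= 1 / (1 + k a). The induction step is (1 - a) (1 + (k + 1)
    a) = 1 + k a - (k + 1) a^2. *)
Lemma bernoulli_mul_le {R : realDomainType} (a : R) (k : nat) :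
  0 <= a -> a <= 1 -> (1 - a) ^+ k * (1 + k%:R * a) <= 1.
Proof.
move=> a0 a1; elim: k => [|k IH]; first by rewrite expr0 mul0r addr0 mulr1.
apply: le_trans IH; rewrite exprSr -mulrA ler_wpM2l ?exprn_ge0 ?subr_ge0//.
rewrite -natr1.
have : 0 <= (k%:R + 1) * a ^+ 2 by rewrite mulr_ge0 ?sqr_ge0// addr_ge0.
nra.
Qed.

Lemma coord_samples_same_law {d dT : measure_display} {Omega : measurableType d}
    {T : measurableType dT} {R : realType} (P : probability Omega R) (n m : nat)
    (Y : 'I_n -> nat -> Omega -> T) (i k : 'I_n) (A : set (m.-tuple T)) :
  (forall i j, measurable_fun setT (Y i j)) ->
  mutual_indep P (fun ij : 'I_n * nat => Y ij.1 ij.2) ->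
  (forall j B, measurable B -> P (Y i j @^-1` B) = P (Y k j @^-1` B)) ->
  measurable A ->
  P (coord_samples m Y i @^-1` A) = P (coord_samples m Y k @^-1` A).
Proof.
move=> mY PY ik.
apply: (tuple_law_unique m P P); try exact: measurable_coord_samples.
  by rewrite ltey_eq fin_num_measure.
move=> C mC; rewrite !preimage_rect_coord.
apply: (etrans (mutual_indep_coord P n Y i PY _ _ (iota_uniq 0 m) (fun j _ => mC j))).
apply/esym/(etrans (mutual_indep_coord P n Y k PY _ _ (iota_uniq 0 m) (fun j _ => mC j))).
by apply: eq_bigr => j _; rewrite ik.
Qed.

Section recovery.
Context {d dT : measure_display} {Omega : measurableType d}
  {T : measurableType dT} {R : realType}.
Variables (P : probability Omega R) (n m : nat) (Y : 'I_n -> nat -> Omega -> T).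
Variables (A : set (m.-tuple T)) (S : {set 'I_n}).
Hypotheses (mY : forall i j, measurable_fun setT (Y i j)) (mA : measurable A).
Hypothesis PY : mutual_indep P (fun ij : 'I_n * nat => Y ij.1 ij.2).

Let W := coord_samples m Y.

Lemma measurable_coord_samples_preimage i B :
  measurable B -> measurable (coord_samples m Y i @^-1` B).
Proof.
by move=> mB; rewrite -[_ @^-1` _]setTI; exact: (measurable_coord_samples n m Y i mY).
Qed.

Lemma recovered_coord w i : Shat Y A w = S -> (i \in S) <-> A (W i w).
Proof.
move=> <-; rewrite inE; split; first by move/asboolP.
by move=> ?; exact/asboolP.
Qed.

Lemma recoveryE : [set w | Shat Y A w = S] =
  \bigcap_(i in [set: 'I_n]) (W i @^-1` (if i \in S then A else ~` A)).
Proof.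
apply/seteqP; split=> [w SE i _|w Aw /=].
  have := recovered_coord w i SE; rewrite /preimage /=.
  by case: ifPn => [iS [+ _]|iS [_ h]]; [exact|move=> /h; exact/negP].
apply/setP => i; rewrite inE; have := Aw i I; rewrite /preimage /=.
by case: ifPn => _ h; apply/asboolP.
Qed.

Lemma measurable_recovery : measurable [set w | Shat Y A w = S].
Proof.
rewrite recoveryE; apply: fin_bigcap_measurable; first exact: finite_finset.
move=> i _; apply: measurable_coord_samples_preimage.
by case: ifP => // _; exact: measurableC.
Qed.

Lemma err_probE : err_prob P Y A S = (1 - P [set w | Shat Y A w = S])%E.
Proof. by rewrite -probability_setC//; exact: measurable_recovery. Qed.

Lemma recovery_le_detect i : i \in S ->
  (P [set w | Shat Y A w = S] <= P (W i @^-1` A))%E.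
Proof.
move=> iS; apply: le_measure; rewrite ?inE.
- exact: measurable_recovery.
- exact: measurable_coord_samples_preimage.
- by move=> w /= /(recovered_coord w i)[+ _]; apply.
Qed.

(** Exact recovery rejects every coordinate outside [S]; these rejections are independent and, the
    samples having the same law, equally likely. *)
Lemma recovery_le_reject i0 : i0 \notin S ->
  (forall i j B, i \notin S -> measurable B ->
    P (Y i j @^-1` B) = P (Y i0 j @^-1` B)) ->
  (P [set w | Shat Y A w = S] <=
    ((1 - fine (P (W i0 @^-1` A))) ^+ (n - #|S|))%:E)%E.
Proof.
move=> i0S same.
have mAC : measurable (~` A) by exact: measurableC.
apply: (@le_trans _ _ (P (\bigcap_(i in [set` enum (~: S)]) (W i @^-1` (~` A))))).
  apply: le_measure; rewrite ?inE.
  - exact: measurable_recovery.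
  - apply: fin_bigcap_measurable; first exact: finite_seq.
    by move=> i _; exact: measurable_coord_samples_preimage.
  - move=> w SE i /=; rewrite mem_enum inE => /negP iS AW.
    by apply: iS; exact/(recovered_coord w i SE).
have -> := indep_coord_samples P n m Y mY PY (enum (~: S)) (fun=> ~` A)
  (enum_uniq _) (fun _ _ => mAC).
rewrite (eq_big_seq (fun=> (1 - fine (P (W i0 @^-1` A)))%:E)).
  rewrite prodEFin lee_fin big_const_seq count_predT -cardE (cardsCs (~: S)) finset.setCK card_ord.
  by rewrite iter_mulr_1.
move=> i; rewrite mem_enum inE => iS.
have mWi : measurable (W i @^-1` A) by exact: measurable_coord_samples_preimage.
apply: (etrans (probability_setC P mWi)).
have -> : P (W i @^-1` A) = P (W i0 @^-1` A).
  by apply: coord_samples_same_law => // j B; exact: same.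
rewrite EFinB fineK// fin_num_measure//.
exact: measurable_coord_samples_preimage.
Qed.

End recovery.

Lemma law_integral {d dT : measure_display} {Omega : measurableType d}
    {T : measurableType dT} {R : realType} (P : {measure set Omega -> \bar R})
    (nu : {measure set T -> \bar R}) (X : Omega -> T) (h : T -> R) (B : set T) :
  measurable_fun setT X -> measurable_fun setT h -> measurable B ->
  (forall B, measurable B -> P (X @^-1` B) = nu B) ->
  (\int[P]_(w in X @^-1` B) (h (X w))%:E = \int[nu]_(y in B) (h y)%:E)%E.
Proof.
move=> mX mh mB XB; pose hB y := h y * \1_B y.
transitivity (\int[P]_w (hB (X w) * cst 1 w)%:E)%E.
  rewrite integral_mkcond; apply: eq_integral => w _.
  rewrite patchE /hB indicE /= mulr1; case: ifPn => [/set_mem Bw|/negP Bw].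
    by rewrite mem_set ?mulr1.
  by rewrite memNset ?mulr0// => h'; apply: Bw; exact: mem_set.
rewrite (integral_transfer P nu X (cst 1) hB)//.
- rewrite [RHS]integral_mkcond; apply: eq_integral => y _.
  by rewrite patchE /hB indicE; case: ifPn => _; rewrite ?mulr1 ?mulr0.
- by apply: measurable_funM => //; exact: measurable_indic.
- move=> C mC; rewrite -XB// -[RHS]mul1e -integral_cst//.
  by rewrite -[_ @^-1` _]setTI; exact: mX.
Qed.

(* The hypothesis forces every factor to be positive, so the junk value
   ln 0 = 0 never enters. *)
Lemma prod_gt_sum_ln {R : realType} (s : seq nat) (r : nat -> R) (t : R) :
  (forall j, 0 <= r j) -> expR t < \prod_(j <- s) r j -> t < \sum_(j <- s) ln (r j).
Proof.
move=> r0 rt; rewrite -ltr_expR expR_sum; apply: (lt_le_trans rt).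
rewrite le_eqVlt; apply/orP; left; apply/eqP; apply: eq_big_seq => j js.
rewrite lnK// posrE lt0r r0 andbT; apply/eqP => rj.
have : 0 < \prod_(j <- s) r j by exact: lt_trans (expR_gt0 t) rt.
by rewrite (big_rem j)//= rj mul0r ltxx.
Qed.

(** The left side is at most lam x (c q - (1 - 5 de / 8)), where c q <= 1 - de + de / 64 + de / 8.
    The bracket is thus at most -15 de / 64, which is below -de / 8. *)
Lemma deviation_exponent_le {R : realFieldType} (c de D eps K v lam x k : R) :
  0 <= c -> c * D = 1 - de -> 0 <= D -> 0 <= eps -> c * eps <= de / 64 ->
  v <= D + eps -> 0 <= lam -> lam * c * K ^+ 2 <= de / 16 -> 0 <= x -> 0 < de ->
  0 <= k <= c * x ->
  k * (lam * v + 2 * (lam * K) ^+ 2) - lam * ((1 - de / 2) * x - de / 8 * x) <=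
  - (lam * de / 8 * x).
Proof.
move=> c0 cD D0 eps0 ceps vD lam0 lamK x0 de0 /andP[k0 kx].
pose q := D + eps + 2 * lam * K ^+ 2.
have q0 : 0 <= q by rewrite !addr_ge0// mulr_ge0 ?sqr_ge0// mulr_ge0.
have h1 : lam * v + 2 * (lam * K) ^+ 2 <= lam * q.
  have := ler_wpM2l lam0 vD; rewrite /q; nra.
have h2 : k * (lam * v + 2 * (lam * K) ^+ 2) <= k * (lam * q) by rewrite ler_wpM2l.
have h3 : k * (lam * q) <= c * x * (lam * q) by rewrite ler_wpM2r// mulr_ge0.
have h4 : c * q <= 1 - de + de / 64 + de / 8.
  rewrite /q; have -> : c * (D + eps + 2 * lam * K ^+ 2) =
    c * D + c * eps + 2 * (lam * c * K ^+ 2) by ring.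
  by rewrite cD; lra.
have lx0 : 0 <= lam * x by rewrite mulr_ge0.
have h5 := ler_wpM2l lx0 h4.
have h6 : c * x * (lam * q) = lam * x * (c * q) by ring.
have : 0 <= lam * x * de by rewrite mulr_ge0// ltW.
move: h2 h3 h5; rewrite h6; nra.
Qed.

(** The change of measure at level exp(t) leaves the event that the likelihood ratio under [nu1] is
    large, which is a deviation of the sum of the ln r(Y_j). *)
Lemma detection_le {d dT : measure_display} {Omega : measurableType d}
    {T : measurableType dT} {R : realType} (P : probability Omega R) (n m : nat)
    (Y : 'I_n -> nat -> Omega -> T) (nu0 nu1 : {measure set T -> \bar R})
    (i0 i1 : 'I_n) (r V : T -> R) (A : set (m.-tuple T)) (K v lam eps t t1 : R) :
  (forall i j, measurable_fun setT (Y i j)) ->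
  mutual_indep P (fun ij : 'I_n * nat => Y ij.1 ij.2) ->
  (forall j B, measurable B -> P (Y i0 j @^-1` B) = nu0 B) ->
  (forall j B, measurable B -> P (Y i1 j @^-1` B) = nu1 B) ->
  measurable_fun setT r -> (forall y, 0 <= r y) ->
  (forall B, measurable B -> (\int[nu0]_(y in B) (r y)%:E)%E = nu1 B) ->
  measurable_fun setT V -> (forall y, `|V y| <= K) ->
  (\int[nu1]_y (V y)%:E = v%:E)%E ->
  (\int[nu1]_y (`|ln (r y) - V y|)%:E <= eps%:E)%E ->
  0 <= lam -> lam * K <= 1 / 2 -> 0 < t1 -> measurable A ->
  (P (coord_samples m Y i1 @^-1` A) <=
   (expR t)%:E * P (coord_samples m Y i0 @^-1` A) +
   (expR (m%:R * (lam * v + 2 * (lam * K) ^+ 2) - lam * (t - t1))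
    + m%:R * eps / t1)%:E)%E.
Proof.
move=> mY PY Y0 Y1 mr r0 rnu mV VK Vv Veps lam0 lamK t10 mA.
have mlr : measurable_fun setT (fun y => ln (r y)).
  exact: (measurableT_comp (@measurable_ln R) mr).
have lawT h : measurable_fun setT h -> forall j,
    (\int[P]_w (h (Y i1 j w))%:E = \int[nu1]_y (h y)%:E)%E.
  move=> mh j; have := law_integral P nu1 (Y i1 j) h setT (mY i1 j) mh measurableT (Y1 j).
  by rewrite preimage_setT.
apply: (le_trans (change_of_measure_le P n m Y i0 i1 r A (expR t) mY PY mr r0 _ mA _)).
- move=> j B mB; rewrite (law_integral P nu0 (Y i0 j) r B)// ?rnu ?Y1//.
  by move=> C mC; exact: Y0.
- exact: expR_ge0.
apply: leeD => //.
apply: le_trans (sum_deviation_le P (Y i1) (fun y => ln (r y)) V m K v lam eps t t1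
  (mutual_indep_coord P n Y i1 PY) (mY i1) mlr mV VK _ _ lam0 lamK t10).
- apply: le_measure; rewrite ?inE.
  + rewrite (_ : [set w | _] = (fun w => \prod_(j <- iota 0 m) r (Y i1 j w)) @^-1` `]expR t, +oo[).
      rewrite -[_ @^-1` _]setTI; apply: measurable_prod => // j _.
      exact: (measurableT_comp mr (mY i1 j)).
    by apply/seteqP; split=> w; rewrite /= in_itv /= andbT.
  + rewrite (_ : [set w | _] = (fun w => \sum_(j <- iota 0 m) ln (r (Y i1 j w))) @^-1` `]t, +oo[).
      rewrite -[_ @^-1` _]setTI; apply: measurable_sum => // j.
      exact: (measurableT_comp mlr (mY i1 j)).
    by apply/seteqP; split=> w; rewrite /= in_itv /= andbT.
  + by move=> w /=; apply: prod_gt_sum_ln.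
- by move=> j; rewrite lawT.
- move=> j; rewrite (lawT (fun y => `|ln (r y) - V y|))//.
  by apply: measurableT_comp => //; exact: measurable_funB.
Qed.

(** The limsup is an infimum of tail suprema, so some tail supremum is already below [l]; it serves
    as [b]. *)
Lemma limn_esup_lt {R : realType} (u : (\bar R)^nat) (l : \bar R) :
  (limn_esup u < l)%E ->
  exists b : \bar R, exists N : nat, (b < l)%E /\ forall n, (N <= n)%N -> (u n <= b)%E.
Proof.
rewrite /limn_esup limf_esupE => /ereal_inf_lt[_ [V [N _ NV] <-] Vl].
exists (ereal_sup (u @` V)), N; split => // n Nn.
by apply: ereal_sup_ubound; exists n => //; exact: NV.
Qed.

Lemma limn_einf_ge {R : realType} (u : (\bar R)^nat) (l : \bar R) (N : nat) :
  (forall n, (N <= n)%N -> (l <= u n)%E) -> (l <= limn_einf u)%E.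
Proof.
move=> lu; rewrite /limn_einf /limn_esup limf_esupE leeNr.
apply: (@le_trans _ _ (ereal_sup ((fun n => - u n)%E @` [set n | (N <= n)%N]))).
  by apply: ereal_inf_lbound; exists [set n | (N <= n)%N] => //; exists N.
by apply: ge_ereal_sup => _ [n Nn <-]; rewrite leeN2; exact: lu.
Qed.

Lemma expRN_le {R : realType} (y b : R) : 0 <= b -> b <= y -> expR (- y) <= (1 + b)^-1.
Proof.
move=> b0 le_by; rewrite expRN lef_pV2 ?posrE ?expR_gt0//; last by lra.
by apply: le_trans (expR_ge1Dx y); lra.
Qed.

(** Bernoulli's bound gives (1 + k a) / 2 <= 1, so k a <= 1, and n <= 2 k doubles this. *)
Lemma false_alarm_lt {R : realFieldType} (a : R) (n k : nat) :
  0 <= a -> a <= 1 -> (n <= 2 * k)%N -> 1 / 2 < (1 - a) ^+ k -> a * n%:R <= 2.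
Proof.
move=> a0 a1 nk h; have := bernoulli_mul_le a k a0 a1.
have ka0 : 0 <= k%:R * a by rewrite mulr_ge0.
have : n%:R <= 2 * k%:R :> R by rewrite -natrM ler_nat.
move=> /(ler_wpM2l a0) nka le1.
have : (1 / 2) * (1 + k%:R * a) <= 1.
  by apply: le_trans le1; rewrite ler_wpM2r ?addr_ge0// ltW.
lra.
Qed.

Theorem theorem2 (R : realType)
  (dT : measure_display) (T : measurableType dT)
  (mu : {measure set T -> \bar R}) (p0 p1 : T -> R)
  (d : measure_display) (Omega : measurableType d) (P : probability Omega R)
  (s m : nat -> nat) (S : forall n : nat, {set 'I_n})
  (Y : forall n : nat, 'I_n -> nat -> Omega -> T)
  (A : forall n : nat, set ((m n).-tuple T)) :
  (* P0, P1: distinct densities w.r.t. mu with common support *)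
  is_density mu p0 -> is_density mu p1 ->
  (forall y, 0 < p0 y <-> 0 < p1 y) ->
  ~ (forall B, measurable B -> dens_prob mu p0 B = dens_prob mu p1 B) ->
  (* sparsity parameters *)
  {homo s : a b / (a <= b)%N} -> {homo m : a b / (a <= b)%N} ->
  (forall n, (2 <= n)%N -> [/\ (0 < s n)%N, (2 * s n <= n)%N & #|S n| = s n]) ->
  ((fun n => (s n)%:R / n%:R) : R^nat) @ \oo --> 0 ->
  (* the sampling model *)
  (forall n i j, measurable_fun setT (Y n i j)) ->
  (forall n, mutual_indep P (fun ij : 'I_n * nat => Y n ij.1 ij.2)) ->
  (forall n i j B, measurable B ->
     P (Y n i j @^-1` B) = dens_prob mu (if i \in S n then p1 else p0) B) ->
  (* a (measurable) non-sequential uniform coordinate-wise procedure *)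
  (forall n, measurable (A n)) ->
  (limn_esup (fun n => ((m n)%:R / ln n%:R)%:E) < (KL mu p1 p0)^-1)%E ->
  ((1 / 2)%:E <= limn_einf (fun n => err_prob P (Y n) (A n) (S n)))%E.
Proof.
move=> [mp0 p0_ge0 p0_1] [mp1 p1_ge0 p1_1] supp neq _ _ Ss _ mY PY law mA.
move=> /limn_esup_lt[b [N1 [bKL mb]]].
have lnn_ge0 n : 0 <= ln n%:R :> R.
  by case: n => [|n]; [rewrite ln0|apply: ln_ge0; rewrite ler1n].
have b0 : (0 <= b)%E.
  by apply: le_trans (mb N1 (leqnn _)); rewrite lee_fin divr_ge0.
have [KLy|[D [D0 KLD intf]]] :=
    KL_finite_pos mu p0 p1 mp0 p0_ge0 p0_1 mp1 p1_ge0 p1_1 supp neq.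
  (* For infinite divergence the threshold is 0, and a nonnegative ratio cannot have limsup below
     it. *)
  by move: bKL; rewrite KLy invey ltNge b0.
have [b' b'E] : exists b' : R, b = b'%:E.
  move: b0 bKL; rewrite KLD inver gt_eqF//.
  by case: (b) => // b' _ _; exists b'.
move: b0 bKL mb; rewrite {}b'E KLD inver gt_eqF// lee_fin lte_fin => b0 bD mb.
(* The midpoint keeps [c * D < 1] and is positive even when [b' = 0], which allows division by
   [c]. *)
pose c : R := (b' + D^-1) / 2.
have Di0 : 0 < D^-1 by rewrite invr_gt0.
have c0 : 0 < c by rewrite /c; lra.
have bc : b' <= c by rewrite /c; lra.
have cD : c * D < 1 by rewrite -ltr_pdivlMr// div1r /c; lra.
clearbody c.
pose de : R := 1 - c * D.
have de0 : 0 < de by rewrite subr_gt0.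
(* This value makes the Markov term at most c x eps / (de x / 8) = 1/8 and costs only de / 64 in the
   Chernoff exponent. *)
pose eps : R := de / (64 * c).
have eps0 : 0 < eps by rewrite divr_gt0// mulr_gt0.
have ceps : c * eps = de / 64 by rewrite /eps; field; rewrite gt_eqF.
pose nu0 := density_measure mu p0 mp0 p0_ge0.
pose nu1 := density_measure mu p1 mp1 p1_ge0.
pose r y := p1 y / p0 y.
have mr : measurable_fun setT r.
  by apply: (measurable_lr p0 p1).
have r0 y : 0 <= r y by rewrite divr_ge0.
have mlr : measurable_fun setT (fun y => ln (r y)).
  exact: (measurableT_comp (@measurable_ln R) mr).
have change h : measurable_fun setT h ->
    (\int[nu1]_y (h y)%:E = \int[mu]_y (h y * p1 y)%:E)%E.
  by move=> mh; rewrite -(integral_transfer mu nu1 id p1 h).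
have int_llr : (\int[nu1]_y (ln (r y))%:E = D%:E)%E.
  rewrite change// -KLD KLE//; apply: eq_integral => y _.
  by rewrite mulrC.
have integrable_llr : nu1.-integrable setT (EFin \o (fun y => ln (r y))).
  apply/integrableP; split; first exact/measurable_EFinP.
  move/integrableP : intf => [_]; apply: le_lt_trans.
  rewrite -[leLHS]/(\int[nu1]_y (`|ln (r y)|)%:E)%E change; last first.
    by apply: measurableT_comp.
  rewrite le_eqVlt; apply/orP; left; apply/eqP; apply: eq_integral => y _ /=.
  by rewrite normrM (ger0_norm (p1_ge0 y)) mulrC.
have [V [K [v [mV [K0 VK] Vv vD Veps]]]] :=
  bounded_L1_approx nu1 _ D eps integrable_llr int_llr eps0.
have K1 : 0 < K + 1 by lra.
(* The two entries give [lamK] and [lamcK]; [K + 1] in place of [K] keeps the denominators positive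
   when [K = 0]. *)
pose lam : R := Num.min (1 / (2 * (K + 1))) (de / (16 * c * (K + 1) ^+ 2)).
have lam0 : 0 < lam.
  rewrite lt_min; apply/andP; split; first by rewrite divr_gt0// mulr_gt0.
  by rewrite divr_gt0// mulr_gt0 ?exprn_gt0// mulr_gt0.
have lamK : lam * K <= 1 / 2.
  apply: (@le_trans _ _ (lam * (K + 1))); first by rewrite ler_wpM2l ?(ltW lam0)//; lra.
  rewrite -ler_pdivlMr// ge_min; apply/orP; left.
  by rewrite le_eqVlt; apply/orP; left; apply/eqP; field; rewrite gt_eqF.
have lamcK : lam * c * K ^+ 2 <= de / 16.
  apply: (@le_trans _ _ (lam * c * (K + 1) ^+ 2)).
    apply: ler_wpM2l; first by rewrite mulr_ge0 ?ltW.
    by apply: lerXn2r; rewrite ?nnegrE; lra.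
  rewrite -mulrA -ler_pdivlMr ?mulr_gt0 ?exprn_gt0//.
  rewrite ge_min; apply/orP; right.
  by rewrite le_eqVlt; apply/orP; left; apply/eqP; field; rewrite !gt_eqF.
(* For x >= x0 the first summand gives de x / 2 >= 15 and the second lam de x / 8 >= 7, so the
   exponentials are at most 1/16 and 1/8. The choice of [N2] ensures ln n >= x0. *)
pose x0 : R := 30 / de + 56 / (lam * de).
have lamde0 : 0 < lam * de by exact: mulr_gt0.
pose N2 := (Num.truncn (expR x0)).+1.
apply: (limn_einf_ge _ _ (maxn N1 (maxn N2 2))) => n.
rewrite !geq_max => /and3P[N1n N2n n2].
have [sn0 sn2 cardS] := Ss n n2.
have n0 : 0 < n%:R :> R by rewrite ltr0n (leq_trans _ n2).
set x : R := ln n%:R.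
have ex : expR x = n%:R by rewrite /x lnK.
have x0x : x0 <= x.
  rewrite -ler_expR ex; apply: ltW; apply: (lt_le_trans (truncnS_gt _)).
  by rewrite ler_nat.
have x0_gt : 0 < x0 by rewrite addr_gt0// divr_gt0.
have x_gt0 : 0 < x by exact: lt_le_trans x0x.
have mc : (m n)%:R <= c * x.
  have := mb n N1n; rewrite lee_fin -/x => /le_trans/(_ bc).
  by rewrite ler_pdivrMr.
have /card_gt0P[i1 i1S] : (0 < #|S n|)%N by rewrite cardS.
have /card_gt0P[i0] : (0 < #|~: S n|)%N.
  by rewrite cardsCs finset.setCK card_ord cardS subn_gt0 (leq_trans _ sn2)// ltn_Pmull.
rewrite inE => i0S.
have lawS i : i \in S n -> forall j B, measurable B -> P (Y n i j @^-1` B) = nu1 B.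
  by move=> iS j B mB; rewrite law// iS.
have lawSC i : i \notin S n -> forall j B, measurable B -> P (Y n i j @^-1` B) = nu0 B.
  by move=> iS j B mB; rewrite law// (negbTE iS).
have mWA i : measurable (coord_samples (m n) (Y n) i @^-1` A n).
  by apply: measurable_coord_samples_preimage.
have mrec := measurable_recovery n (m n) (Y n) (A n) (S n) (mY n) (mA n).
rewrite err_probE//.
(* This is the probability of exact recovery; the error probability is [1 - pe]. *)
set pe := P [set w | _].
have peE : pe = (fine pe)%:E by rewrite fineK// fin_num_measure.
rewrite peE -EFinB lee_fin; suff : fine pe <= 1 / 2 by lra.
rewrite leNgt; apply/negP => pe2.
have a_fin i : P (coord_samples (m n) (Y n) i @^-1` A n) =
    (fine (P (coord_samples (m n) (Y n) i @^-1` A n)))%:E.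
  by rewrite fineK// fin_num_measure.
set a := fine (P (coord_samples (m n) (Y n) i0 @^-1` A n)).
have a0 : 0 <= a by exact: fine_ge0.
have a1 : a <= 1.
  by rewrite -lee_fin -a_fin; exact: probability_le1.
have small_a : a * n%:R <= 2.
  apply: (false_alarm_lt a n (n - s n)) => //.
    by rewrite mulnBr mul2n -addnn -addnBA ?leq_addr.
  apply: (lt_le_trans pe2); rewrite -lee_fin -peE -cardS.
  apply: recovery_le_reject => // i j B iS mB.
  by rewrite lawSC// lawSC.
(* With t = (1 - de/2) x and t1 = de x / 8, each of the three terms is at most 1/8. *)
have : fine pe <= expR ((1 - de / 2) * x) * a +
    (expR ((m n)%:R * (lam * v + 2 * (lam * K) ^+ 2)
       - lam * ((1 - de / 2) * x - de / 8 * x))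
     + (m n)%:R * eps / (de / 8 * x)).
  rewrite -lee_fin -peE.
  apply: (@le_trans _ _ (P (coord_samples (m n) (Y n) i1 @^-1` A n))).
    exact: recovery_le_detect.
  rewrite EFinD EFinM -a_fin.
  apply: (detection_le P n (m n) (Y n) nu0 nu1 i0 i1 r V) => //.
  - exact: lawSC.
  - exact: lawS.
  - by move=> B mB; exact: integral_lr.
  - exact: ltW.
  - by rewrite mulr_gt0// divr_gt0.
have m0 : (0 : R) <= (m n)%:R by [].
have t1_le : expR ((1 - de / 2) * x) * a <= 1 / 8.
  (* Since exp(x) = n, the term becomes exp(-de x / 2) times n a, at most (1/16) * 2. *)
  have -> : (1 - de / 2) * x = - (de / 2 * x) + x by ring.
  rewrite expRD ex -mulrA [n%:R * a]mulrC.
  have e16 : expR (- (de / 2 * x)) <= (1 + 15)^-1.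
    apply: expRN_le => //; have : 30 / de <= x.
      by apply: le_trans x0x; rewrite lerDl divr_ge0// ltW.
    by rewrite ler_pdivrMr//; lra.
  have := ler_pM (expR_ge0 _) (mulr_ge0 a0 (ltW n0)) e16 small_a.
  have -> : (1 + 15)^-1 * 2 = 1 / 8 :> R by field.
  exact.
have t2_le : expR ((m n)%:R * (lam * v + 2 * (lam * K) ^+ 2)
       - lam * ((1 - de / 2) * x - de / 8 * x)) <= 1 / 8.
  have cDde : c * D = 1 - de by rewrite /de; ring.
  have ceps' : c * eps <= de / 64 by rewrite ceps.
  have mc' : (0 : R) <= (m n)%:R <= c * x by apply/andP; split.
  have := deviation_exponent_le c de D eps K v lam x (m n)%:R (ltW c0) cDde
    (ltW D0) (ltW eps0) ceps' vD (ltW lam0) lamcK (ltW x_gt0) de0 mc'.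
  move=> le_exp; apply: (@le_trans _ _ (expR (- (lam * de / 8 * x)))).
    by rewrite ler_expR.
  have <- : (1 + 7)^-1 = 1 / 8 :> R by field.
  apply: expRN_le => //; have : 56 / (lam * de) <= x.
    by apply: le_trans x0x; rewrite lerDr divr_ge0// ltW.
  by rewrite ler_pdivrMr//; lra.
have t3_le : (m n)%:R * eps / (de / 8 * x) <= 1 / 8.
  rewrite ler_pdivrMr ?mulr_gt0 ?divr_gt0//.
  have := ler_wpM2r (ltW eps0) mc.
  have -> : c * x * eps = c * eps * x by ring.
  by rewrite ceps; lra.
(* The three terms add up to at most 3/8, against [pe2]. *)
by move: pe2 t1_le t2_le t3_le; lra.
Qed.
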